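(* For every $\rho\in[1,\frac{e}{e-1}]$ there is a randomized algorithm for learning-augmented (continuous-time) ski rental which, on every instance (with any rental cost $\alpha>0$, buying cost $\beta>0$, season length $\ell\ge 0$ and prediction $\tau\ge 0$), has expected cost at most $\rho\cdot\mathrm{OPT}+\mu(\rho)\cdot\eta$, where $\mathrm{OPT}=\min\{\alpha\ell,\beta\}$ and $\eta=\alpha|\tau-\ell|$.
   Context: Learning-augmented continuous-time ski rental: there is a rental cost $\alpha>0$ per unit time and a buying cost $\beta>0$. The season length $\ell\ge 0$ is unknown to the algorithm; the algorithm knows $\alpha,\beta$ and a prediction $\tau\ge 0$ of $\ell$. A (randomized) algorithm chooses a (random) buying time $A\in[0,\infty]$ depending only on $\alpha,\beta,\tau$; its cost is $\alpha A+\beta$ if $A<\ell$ and $\alpha\ell$ otherwise. The optimal offline cost is $\mathrm{OPT}=\min\{\alpha\ell,\beta\}$ and the prediction error is $\eta=\alpha|\tau-\ell|$. For $\rho\in[1,\frac{e}{e-1}]$ define $\mu(\rho)=\max\left\{\frac{1-\rho\frac{e-1}{e}}{\ln 2},\ \rho(1-T)e^{-T}\right\}$, where $T\in[0,1]$ is the solution of $T^2e^{-T}=1-\frac1\rho$. *)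

(* Defs.v *)
From HB Require Import structures.
From mathcomp Require Import all_boot all_order all_algebra.
From mathcomp Require Import ring lra.
From mathcomp Require Import all_classical all_reals all_analysis.
From mathcomp Require Import measurable_realfun.

Set Implicit Arguments.
Unset Strict Implicit.
Unset Printing Implicit Defensive.

Import Order.TTheory GRing.Theory Num.Theory.
Import numFieldNormedType.Exports.

Local Open Scope classical_set_scope.
Local Open Scope ring_scope.

Record random_buying_time (R : realType) := RandomBuyingTime {
  coin_display : measure_display ;
  coin_space : measurableType coin_display ;
  coin_law : probability coin_space R ;
  buying_time : {RV coin_law >-> \bar R} ;
  buying_time_ge0 : forall w, (0 <= buying_time w)%E }.

(* Arguments are, in order, the rental cost, the buying cost and the
   prediction; the season length is not available to the algorithm. *)
Definition randomized_algorithm (R : realType) :=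
  R -> R -> R -> random_buying_time R.

(* On the first branch A is finite as soon as 0 <= A, so fine loses nothing. *)
Definition cost (R : realType) (alpha beta l : R) (A : \bar R) : R :=
  if (A < l%:E)%E then alpha * fine A + beta else alpha * l.

Definition expected_cost (R : realType) (alpha beta l : R)
    (X : random_buying_time R) : \bar R :=
  ('E_(coin_law X) [fun w => cost alpha beta l (buying_time X w)])%E.

Definition OPT (R : realType) (alpha beta l : R) : R :=
  Num.min (alpha * l) beta.

Definition prediction_error (R : realType) (alpha l tau : R) : R :=
  alpha * `|tau - l|.

Definition is_T (R : realType) (rho T : R) : Prop :=
  0 <= T <= 1 /\ T ^+ 2 * expR (- T) = 1 - rho^-1.

(* The default value 0 is never used in the range of rho under consideration,
   see T_rhoP and is_T_unique. *)
Definition T_rho (R : realType) (rho : R) : R := xget 0 [set T | is_T rho T].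

Definition mu (R : realType) (rho : R) : R :=
  let e := expR 1 in
  let T := T_rho rho in
  Num.max ((1 - rho * ((e - 1) / e)) / ln 2) (rho * (1 - T) * expR (- T)).

Lemma is_T_exists (R : realType) (rho : R) :
  1 <= rho <= expR 1 / (expR 1 - 1) -> exists T, is_T rho T.
Proof.
move=> /andP[rho1 rhoe].
have e1 : (1 : R) < expR 1 by rewrite expR_gt1.
have rho0 : 0 < rho by lra.
have cf : {within `[(0 : R), 1], continuous (fun T : R => T ^+ 2 * expR (- T))}.
  apply: continuous_subspaceT => x; apply: cvgM.
    by apply: exprn_continuous.
  apply: continuous_comp; first exact: continuousN.
  exact: continuous_expR.
have [|T T01 fT] := @IVT R _ 0 1 (1 - rho^-1) ler01 cf.
  rewrite expr0n/= mul0r expr1n mul1r.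
  rewrite min_l ?max_r ?expR_ge0//; apply/andP; split.
    by rewrite subr_ge0 invf_le1.
  rewrite expRN lerBlDr -lerBlDl.
  have -> : 1 - (expR 1)^-1 = (expR 1 / (expR 1 - 1))^-1 :> R.
    by field; apply/andP; split; lra.
  by rewrite lef_pV2 ?posrE// divr_gt0; lra.
by exists T; split => //; move: T01; rewrite in_itv.
Qed.

Lemma is_T_unique (R : realType) (rho T T' : R) :
  is_T rho T -> is_T rho T' -> T = T'.
Proof.
suff H a b : 0 <= a -> a < b -> b <= 1 ->
    a ^+ 2 * expR (- a) < b ^+ 2 * expR (- b) :> R.
  move=> [/andP[a0 a1] ha] [/andP[b0 b1] hb].
  case: (ltgtP T T') => // h.
    by have := H _ _ a0 h b1; rewrite ha hb ltxx.
  by have := H _ _ b0 h a1; rewrite ha hb ltxx.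
move=> a0 ab b1.
have -> : - b = - a + (a - b) by ring.
rewrite expRD (mulrC (expR (- a))) mulrA ltr_pM2r ?expR_gt0//.
have [->|aN0] := eqVneq a 0.
  by rewrite expr0n/= mulr_gt0 ?expR_gt0// exprn_gt0//; lra.
have a_gt0 : 0 < a by rewrite lt_neqAle eq_sym aN0.
apply: (@lt_le_trans _ _ (b ^+ 2 * (1 + (a - b)))).
  have : 0 < (b - a) * (a + (b - b ^+ 2)) by apply: mulr_gt0; nra.
  nra.
by apply: ler_wpM2l; [exact: sqr_ge0|exact: expR_ge1Dx].
Qed.

Lemma T_rhoP (R : realType) (rho : R) :
  1 <= rho <= expR 1 / (expR 1 - 1) -> is_T rho (T_rho rho).
Proof. by move=> /is_T_exists[T hT]; exact: (xgetI 0 hT). Qed.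

(* Main.v *)
Require Import Defs.
From HB Require Import structures.
From mathcomp Require Import all_boot all_order all_algebra ring lra.
From mathcomp Require Import all_classical all_reals all_analysis.
From mathcomp Require Import measurable_realfun.

(** After rescaling time and money, [alpha = beta = 1]; write [y] for the
    prediction and [x] for the season length. Buying with an atom at [0], with
    densities proportional to [e^t] on intervals, and never with the remaining
    probability, has an expected cost that is piecewise affine in [x], as is the
    bound [rho min(x, 1) + mu |y - x|]. The weights are chosen to keep the bound
    tight for as long as possible; buying stops when the remaining probability
    vanishes, or early enough that it is at most [mu], so that the cost grows
    beyond [max(y, 1)] no faster than the bound. The two terms of [mu] are what
    this requires: for [y = 1 + z], and for small [y = 1 - z], one needs
    [rho z e^-z <= rho - 1 + mu z], whose worst case [z = T] gives the second
    term; for the other [y < 1] one needs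
    [rho <= e (rho - 1 + mu (y - 1 + 2 e^-y))], whose worst case [y = ln 2]
    gives the first. *)

Set Implicit Arguments.
Unset Strict Implicit.
Unset Printing Implicit Defensive.

Import Order.TTheory GRing.Theory Num.Theory.
Import numFieldNormedType.Exports.

Local Open Scope classical_set_scope.
Local Open Scope ring_scope.

(** * Expected cost of buying with an exponential density *)

Lemma cost_ge0 (R : realType) (x : R) (A : \bar R) :
  0 <= x -> (0 <= A)%E -> 0 <= cost 1 1 x A.
Proof.
move=> x0 A0; rewrite /cost; case: ifPn => _; last by rewrite mul1r.
by rewrite mul1r addr_ge0// fine_ge0.
Qed.

Lemma measurable_cost (R : realType) (alpha beta x : R) :
  measurable_fun setT (cost alpha beta x).
Proof.
apply: measurable_fun_ifT => //.
- exact: measurable_fun_lte.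
- by apply: measurable_funD => //; apply: measurable_funM.
Qed.

Lemma integral_ocitv_cst (R : realType) (u v k : R) : u <= v ->
  (\int[lebesgue_measure]_(t in `]u, v]) k%:E = (k * (v - u))%:E)%E.
Proof.
move=> uv; rewrite integral_cst//= lebesgue_measure_itv/= lte_fin.
case: ltP => [_|vu]; first by rewrite -EFinD -EFinM.
by rewrite mule0 (le_anti (introT andP (conj uv vu))) subrr mulr0.
Qed.

Lemma is_derive_mul_ln (R : realType) (c d t : R) : 0 < d -> c < t ->
  is_derive t 1 (fun s => (s - c) * ln ((s - c) / d)) (ln ((t - c) / d) + 1).
Proof.
move=> d0 ct.
have tc0 : 0 < (t - c) / d by rewrite divr_gt0// subr_gt0.
have h1 : is_derive t 1 (fun s : R => s - c) 1.
  by apply: is_derive_eq; rewrite subr0.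
have h2 : is_derive t 1 (fun s : R => (s - c) / d) d^-1.
  by apply: is_derive_eq; rewrite scaler0 add0r /GRing.scale/= mulr1.
have h : is_derive t 1 (fun s : R => ln ((s - c) / d)) (d^-1 * ((t - c) / d)^-1).
  have -> : d^-1 * ((t - c) / d)^-1 = ((t - c) / d)^-1 * d^-1 by rewrite mulrC.
  exact: (@is_derive1_comp _ (@ln R) (fun s => (s - c) / d) _ _ _ (is_derive1_ln tc0)).
apply: is_derive_eq.
rewrite /GRing.scale/= mulr1 addrC; congr (_ + _); field.
by rewrite !gt_eqF// subr_gt0.
Qed.


(** In terms of the buying time [s = ln ((t - c) / d)] the integrand is the cost [s + 1] of buying
    at [s], and [d * s * e^s] is a primitive of [d * (s + 1) * e^s]. *)
Lemma integral_ln_segment (R : realType) (c d a b : R) : 0 < d -> a <= b ->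
  (\int[lebesgue_measure]_(t in `](c + d * expR a)%R, (c + d * expR b)%R])
     (ln ((t - c) / d) + 1)%:E = (d * (expR b * b - expR a * a))%:E)%E.
Proof.
move=> d0; rewrite le_eqVlt => /predU1P[->|ab].
  by rewrite set_itv_ge ?bnd_simp ?ltxx// integral_set0 subrr mulr0.
set p := c + _; set q := c + _.
have pq : p < q by rewrite ltrD2l ltr_pM2l// ltr_expR.
have cp : c < p by rewrite ltrDl mulr_gt0// expR_gt0.
pose F (s : R) := (s - c) * ln ((s - c) / d).
have dF t : p <= t -> is_derive t 1 F (ln ((t - c) / d) + 1).
  by move=> pt; apply: is_derive_mul_ln => //; exact: lt_le_trans pt.
have cln t : p <= t -> {for t, continuous (fun t => ln ((t - c) / d) + 1)}.
  move=> pt; apply: cvgD; last exact: cvg_cst.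
  apply: continuous_comp; last first.
    apply: continuous_ln; rewrite divr_gt0// subr_gt0; exact: lt_le_trans pt.
  by apply: cvgMl; apply: cvgB => //; exact: cvg_cst.
rewrite integral_itv_obnd_cbnd; last first.
  apply: measurable_funTS; apply/measurable_EFinP.
  apply: measurable_funD => //; apply: measurableT_comp; first exact: measurable_ln.
  by apply: measurable_funM => //; apply: measurable_funB.
rewrite (@continuous_FTC2 _ _ F)//.
- rewrite -EFinD /F /p /q; congr (_%:E).
  have hc z : c + z - c = z by ring.
  rewrite !hc.
  have hd z : d * expR z / d = expR z by field; rewrite gt_eqF.
  by rewrite !hd !expRK; ring.
- apply: continuous_in_subspaceT => t; rewrite inE/= in_itv/= => /andP[pt _].
  exact: cln.
- split.
  + by move=> t; rewrite in_itv/= => /andP[/ltW/dF h _]; case: h.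
  + apply: cvg_at_right_filter; apply: differentiable_continuous; apply/derivable1_diffP.
    by case: (dF p (lexx _)).
  + apply: cvg_at_left_filter; apply: differentiable_continuous; apply/derivable1_diffP.
    by case: (dF q (ltW pq)).
- move=> t; rewrite in_itv/= => /andP[/ltW/dF h _]; rewrite derive1E.
  exact: derive_val.
Qed.

(** Inverse transform sampling: uniform outcomes [t] in []c + d * e^a, c + d * e^b]] yield a buying
    time with density [d * e^s] on [[a, b]]. The maximum with [0] keeps the time nonnegative at the
    other outcomes. *)
Definition ln_segment (R : realType) (c d t : R) : \bar R :=
  (Num.max 0 (ln ((t - c) / d)))%:E.

Lemma measurable_ln_segment (R : realType) (c d : R) :
  measurable_fun setT (ln_segment c d).
Proof.
apply/measurable_EFinP; apply: measurable_maxr => //.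
apply: measurableT_comp; first exact: measurable_ln.
by apply: measurable_funM => //; apply: measurable_funB.
Qed.

Lemma ln_segmentE (R : realType) (c d a t : R) : 0 < d -> 0 <= a ->
  c + d * expR a < t -> ln_segment c d t = (ln ((t - c) / d))%:E /\
    a < ln ((t - c) / d).
Proof.
move=> d0 a0 h.
have ea : expR a < (t - c) / d by rewrite ltr_pdivlMr// mulrC; lra.
have al : a < ln ((t - c) / d).
  by rewrite -ltr_expR lnK// posrE (lt_trans _ ea)// expR_gt0.
by split => //; rewrite /ln_segment max_r// ltW// (le_lt_trans a0).
Qed.

(** For [a < x <= b], split at the outcome [c + d * e^x]: earlier purchases contribute at most
    [d * (x * e^x - a * e^a)], later ones [x * d * (e^b - e^x)], and the terms in [e^x] cancel. *)
Lemma integral_cost_ln_segment (R : realType) (c d a b x : R) :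
  0 <= d -> 0 <= a <= b -> 0 <= x ->
  (\int[lebesgue_measure]_(t in `](c + d * expR a)%R, (c + d * expR b)%R])
     (cost 1 1 x (ln_segment c d t))%:E <=
   (d * (expR b * Num.min x b - expR a * Num.min x a))%:E)%E.
Proof.
rewrite le_eqVlt => /predU1P[<-|d0].
  by rewrite !mul0r set_itv_ge ?bnd_simp ?ltxx// integral_set0.
move=> /andP[a0 ab] x0.
have mcost D : measurable_fun D (fun t => (cost 1 1 x (ln_segment c d t))%:E).
  apply: measurable_funTS; apply/measurable_EFinP.
  by apply: measurableT_comp; [exact: measurable_cost|exact: measurable_ln_segment].
have cost0 t : 0 <= cost 1 1 x (ln_segment c d t).
  by rewrite cost_ge0// lee_fin le_max lexx.
have rent a' b' : 0 <= a' -> x <= a' -> a' <= b' ->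
  (\int[lebesgue_measure]_(t in `](c + d * expR a')%R, (c + d * expR b')%R])
     (cost 1 1 x (ln_segment c d t))%:E = (x * (d * (expR b' - expR a')))%:E)%E.
  move=> a'0 xa' ab'.
  have -> : d * (expR b' - expR a') = (c + d * expR b') - (c + d * expR a') by ring.
  rewrite -integral_ocitv_cst; last by rewrite lerD2l ler_pM2l// ler_expR.
  apply: eq_integral => t; rewrite inE/= in_itv/= => /andP[ta _].
  have [-> h] := ln_segmentE d0 a'0 ta.
  by rewrite /cost lte_fin ltNge (ltW (le_lt_trans xa' h))/= mul1r.
(* A cost of at most [A + 1] also holds when the season ends before the purchase, so [x] may lie
   anywhere. *)
have buy b' : a <= b' ->
  (\int[lebesgue_measure]_(t in `](c + d * expR a)%R, (c + d * expR b')%R])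
     (cost 1 1 x (ln_segment c d t))%:E <= (d * (expR b' * b' - expR a * a))%:E)%E.
  move=> ab'; rewrite -(integral_ln_segment c d0 ab').
  apply: ge0_le_integral => //.
  - by move=> t _; rewrite lee_fin.
  - exact: mcost.
  - apply: measurable_funTS; apply/measurable_EFinP.
    apply: measurable_funD => //; apply: measurableT_comp; first exact: measurable_ln.
    by apply: measurable_funM => //; apply: measurable_funB.
  - move=> t; rewrite /= in_itv/= => /andP[ta _].
    have [-> h] := ln_segmentE d0 a0 ta.
    rewrite /cost !lte_fin lee_fin; case: ifPn; rewrite -?leNgt => /= ?; lra.
have [xa|ax] := leP x a.
  rewrite rent// min_l ?(le_trans xa)// lee_fin; nra.
have [xb|bx] := leP x b; last first.
  by rewrite buy.
rewrite (@itv_bndbnd_setU _ _ _ (BRight (c + d * expR x))); last 2 first.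
- by rewrite bnd_simp lerD2l ler_pM2l// ler_expR ltW.
- by rewrite bnd_simp lerD2l ler_pM2l// ler_expR.
rewrite ge0_integral_setU//=; last 3 first.
- exact: mcost.
- by move=> t _; rewrite lee_fin.
-
  apply/disj_setPRL => t /=; rewrite !in_itv/= => /andP[h _].
  by apply/negP; rewrite negb_and -!ltNge h orbT.
rewrite (rent x b)//.
apply: (le_trans (leeD2r _ (buy x (ltW ax)))).
rewrite -EFinD lee_fin; nra.
Qed.

(** * Assembling strategies from atoms and exponential pieces *)

(* The coin is uniform on [0, 1]; only its outcomes up to [u] count, so that
   strategies can be assembled by increasing [u] up to [1]. *)
Definition partial_strategy (R : realType) (u : R) (K : R -> R) :=
  exists A : R -> \bar R, [/\ measurable_fun setT A, forall t, (0 <= A t)%E &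
    forall x, 0 <= x ->
      (\int[lebesgue_measure]_(t in `]0%R, u]) (cost 1 1 x (A t))%:E
        <= (K x)%:E)%E].

Lemma partial_strategy0 (R : realType) : @partial_strategy R 0 (fun=> 0).
Proof.
exists (fun=> 0%E); split => // x x0.
by rewrite set_itv_ge ?bnd_simp ?ltxx// integral_set0.
Qed.

Lemma partial_strategy_extend (R : realType) (u v : R) (K k : R -> R)
    (B : R -> \bar R) :
  0 <= u <= v -> measurable_fun setT B -> (forall t, (0 <= B t)%E) ->
  (forall x, 0 <= x ->
    (\int[lebesgue_measure]_(t in `]u, v]) (cost 1 1 x (B t))%:E
      <= (k x)%:E)%E) ->
  partial_strategy u K -> partial_strategy v (fun x => K x + k x).
Proof.
move=> /andP[u0 uv] mB B0 Bk [A [mA A0 AK]].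
pose C t := if t <= u then A t else B t.
have mC : measurable_fun setT C.
  apply: measurable_fun_ifT => //; exact: measurable_fun_ler.
have C0 t : (0 <= C t)%E by rewrite /C; case: ifPn.
exists C; split => // x x0.
have mcost D : measurable_fun D (fun t => (cost 1 1 x (C t))%:E).
  apply: measurable_funTS; apply/measurable_EFinP.
  by apply: measurableT_comp => //; exact: measurable_cost.
rewrite (@itv_bndbnd_setU _ _ _ (BRight u)) ?bnd_simp//.
rewrite ge0_integral_setU//=; last 3 first.
- exact: mcost.
- by move=> t _; rewrite lee_fin cost_ge0.
- apply/disj_setPRL => t /=; rewrite !in_itv/= => /andP[h _].
  by apply/negP; rewrite negb_and -!ltNge h orbT.
rewrite EFinD; apply: leeD.
- apply: le_trans (AK _ x0); rewrite le_eqVlt; apply/predU1l; apply: eq_integral => t.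
  by rewrite inE/= in_itv/= /C => /andP[_ ->].
- apply: le_trans (Bk _ x0); rewrite le_eqVlt; apply/predU1l; apply: eq_integral => t.
  by rewrite inE/= in_itv/= /C => /andP[ut _]; rewrite leNgt ut.
Qed.

Lemma partial_strategy_atom0 (R : realType) (u q : R) (K : R -> R) :
  0 <= u -> 0 <= q ->
  partial_strategy u K -> partial_strategy (u + q) (fun x => K x + q).
Proof.
move=> u0 q0; apply: (@partial_strategy_extend _ _ _ _ _ (fun=> 0%E)) => //.
  by rewrite u0 lerDl.
move=> x x0; rewrite integral_ocitv_cst ?lerDl// addrAC subrr add0r lee_fin.
by rewrite ler_piMl// /cost; case: ifPn; rewrite lte_fin ?mul1r ?add0r// -leNgt; lra.
Qed.

Lemma partial_strategy_never (R : realType) (u q : R) (K : R -> R) :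
  0 <= u -> 0 <= q ->
  partial_strategy u K -> partial_strategy (u + q) (fun x => K x + q * x).
Proof.
move=> u0 q0; apply: (@partial_strategy_extend _ _ _ _ _ (fun=> +oo%E)) => //.
  by rewrite u0 lerDl.
move=> x x0; rewrite integral_ocitv_cst ?lerDl// addrAC subrr add0r lee_fin.
by rewrite /cost/= mul1r mulrC.
Qed.

Lemma partial_strategy_exp (R : realType) (u d a b : R) (K : R -> R) :
  0 <= u -> 0 <= d -> 0 <= a <= b ->
  partial_strategy u K ->
  partial_strategy (u + d * (expR b - expR a))
    (fun x => K x + d * (expR b * Num.min x b - expR a * Num.min x a)).
Proof.
move=> u0 d0 /andP[a0 ab].
have eab : 0 <= expR b - expR a by rewrite subr_ge0 ler_expR.
(* With this shift the new segment starts at the outcome [u]. *)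
pose c := u - d * expR a.
apply: (@partial_strategy_extend _ _ _ _ _ (ln_segment c d)).
- by rewrite u0 lerDl mulr_ge0.
- exact: measurable_ln_segment.
- by move=> t; rewrite lee_fin le_max lexx.
- move=> x x0.
  have -> : u + d * (expR b - expR a) = c + d * expR b by rewrite /c; ring.
  have -> : u = c + d * expR a by rewrite /c; ring.
  by apply: integral_cost_ln_segment => //; rewrite a0.
Qed.

(** * Rescaling: time in units of [beta / alpha], money in units of [beta] *)

Lemma cost_scale (R : realType) (alpha beta x : R) (A : \bar R) :
  0 < alpha -> 0 < beta -> (0 <= A)%E ->
  cost alpha beta x ((beta / alpha)%:E * A)%E =
    beta * cost 1 1 (x * (alpha / beta)) A.
Proof.
move=> a0 b0; rewrite /cost; case: A => [r|_|//].
  move=> r0; rewrite -EFinM !lte_fin/=.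
  have -> : (beta / alpha * r < x) = (r < x * (alpha / beta)).
    by rewrite -(invf_div beta alpha) ltr_pdivlMr ?divr_gt0// mulrC.
  by case: ifPn => _; field; rewrite ?gt_eqF.
rewrite gt0_muley ?lte_fin ?divr_gt0//=.
by field; rewrite gt_eqF.
Qed.

Lemma partial_strategy1_expected_cost (R : realType) (K : R -> R)
    (alpha beta : R) : 0 < alpha -> 0 < beta -> partial_strategy 1 K ->
  exists X : random_buying_time R, forall l, 0 <= l ->
    (expected_cost alpha beta l X <= (beta * K (l * (alpha / beta)))%:E)%E.
Proof.
move=> a0 b0 [A [mA A0 AK]].
have mB : measurable_fun [set: measurableTypeR R] (fun t => ((beta / alpha)%:E * A t)%E).
  exact: measurable_funeM.
have B0 t : (0 <= (beta / alpha)%:E * A t)%E.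
  by rewrite mule_ge0// lee_fin divr_ge0// ltW.
pose X : {RV (uniform_prob (@ltr01 R)) >-> \bar R} :=
  HB.pack (fun t : measurableTypeR R => ((beta / alpha)%:E * A t)%E)
    (isMeasurableFun.Build _ _ _ _ _ mB).
exists (@RandomBuyingTime R _ _ _ X B0) => l l0.
rewrite /expected_cost/= unlock.
pose x := l * (alpha / beta).
have x0 : 0 <= x by rewrite mulr_ge0// divr_ge0// ltW.
rewrite (eq_integral (fun t : measurableTypeR R => (beta%:E * (cost 1 1 x (A t))%:E)%E)); last first.
  by move=> t _; rewrite cost_scale.
have mcost : measurable_fun [set: measurableTypeR R] (fun t => (cost 1 1 x (A t))%:E).
  apply/measurable_EFinP.
  by apply: measurableT_comp => //; exact: measurable_cost.
rewrite ge0_integralZl_EFin//; last 2 first.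
- by move=> t _; rewrite lee_fin cost_ge0.
- exact: ltW.
rewrite integral_uniform//; last by move=> t; rewrite lee_fin cost_ge0.
rewrite subr0 invr1 mul1e -integral_itv_obnd_cbnd; last exact: measurable_funTS.
by rewrite EFinM lee_pmul2l// AK.
Qed.

(** * Inequalities satisfied by [mu] *)

(** The right side is the tangent of [z * e^-z] at [T]. With [h = z - T], the claim is
    [T + h <= (T + (1 - T) * h) * e^h]; it follows from [e^h >= 1 + h], which leaves the surplus
    [(1 - T) * h^2]. *)
Lemma mul_expRN_le_tangent (R : realType) (T z : R) : 0 <= T <= 1 -> 0 <= z ->
  z * expR (- z) <= T * expR (- T) + (1 - T) * expR (- T) * (z - T).
Proof.
move=> /andP[T0 T1] z0.
have -> : - z = - T - (z - T) by ring.
rewrite expRD (expRN (z - T)).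
set E := expR (- T); set F := expR (z - T).
have -> : T * E + (1 - T) * E * (z - T) = E * (T + (1 - T) * (z - T)) by ring.
rewrite mulrCA ler_pM2l ?expR_gt0// ler_pdivrMr ?expR_gt0//.
have h0 : 0 <= T + (1 - T) * (z - T) by nra.
apply: le_trans (ler_wpM2l h0 (expR_ge1Dx _)).
have T1' : 0 <= 1 - T by lra.
have := mulr_ge0 T1' (sqr_ge0 (z - T)); nra.
Qed.

Section MuBounds.
Context {R : realType} (rho : R).
Hypothesis hrho : 1 <= rho <= expR 1 / (expR 1 - 1).

Let e_gt1 : (1 : R) < expR 1. Proof. by rewrite expR_gt1. Qed.
Let ln2_gt0 : 0 < ln 2 :> R. Proof. by rewrite ln_gt0// ltr1n. Qed.

Let rho_e : rho * (expR 1 - 1) <= expR 1.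
Proof.
by move: hrho => /andP[_]; rewrite ler_pdivlMr// subr_gt0.
Qed.

Lemma mu_ge_ln2 : expR 1 - rho * (expR 1 - 1) <= mu rho * (expR 1 * ln 2).
Proof.
have -> : expR 1 - rho * (expR 1 - 1) =
    (1 - rho * ((expR 1 - 1) / expR 1)) / ln 2 * (expR 1 * ln 2).
  by field; rewrite !gt_eqF// expR_gt0.
by rewrite ler_pM2r ?mulr_gt0 ?expR_gt0// /mu le_max lexx.
Qed.

Lemma mu_ge0 : 0 <= mu rho.
Proof.
rewrite -(@pmulr_lge0 _ (expR 1 * ln 2)) ?mulr_gt0 ?expR_gt0//.
by apply: le_trans mu_ge_ln2; rewrite subr_ge0.
Qed.

Lemma mu_le1 : mu rho <= 1.
Proof.
have [/andP[T0 T1] hT] := T_rhoP hrho.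
case/andP: hrho => rho1 _.
rewrite /mu ge_max; apply/andP; split.
  rewrite ler_pdivrMr// mul1r.
  have e0 : expR 1 != 0 :> R by rewrite gt_eqF// expR_gt0.
  have h : (expR 1)^-1 <= ln 2 :> R.
    have := @expR_ge1Dx R (- ln 2).
    rewrite expRN lnK ?posrE ?ltr0n// => h.
    have e2 : 2 <= expR 1 :> R by have := @expR_ge1Dx R 1; lra.
    apply: (@le_trans _ _ 2^-1); last by lra.
    by rewrite lef_pV2 ?posrE ?expR_gt0.
  have -> : (expR 1 - 1) / expR 1 = 1 - (expR 1)^-1 :> R by field.
  have : 0 < (expR 1)^-1 :> R by rewrite invr_gt0 expR_gt0.
  have : (expR 1)^-1 <= 1 :> R by rewrite invf_le1 ?expR_gt0// ltW.
  nra.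
set T := T_rho rho in T0 T1 hT *.
have rho0 : 0 < rho by lra.
(* The equation of [T] turns the claim into [(1 - T + T^2) * e^-T <= 1]. *)
have E1 : rho * (1 - T ^+ 2 * expR (- T)) = 1.
  by rewrite hT; field; rewrite gt_eqF.
rewrite -[leRHS]E1 -mulrA ler_pM2l//.
have : expR (- T) <= 1 by rewrite -expR0 ler_expR; lra.
have T1' : 0 <= 1 - T by lra.
have := mulr_ge0 (expR_ge0 (- T)) (mulr_ge0 T0 T1'); nra.
Qed.

(** Multiplied by [rho], the tangent at [T] has value [rho * T^2 * e^-T = rho - 1] at [0], by the
    equation of [T], and slope at most [mu]. *)
Lemma mu_ge_tangent (z : R) : 0 <= z -> rho * z <= (rho - 1 + mu rho * z) * expR z.
Proof.
move=> z0.
have [T01 hT] := T_rhoP hrho.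
case/andP: hrho => rho1 _.
have hm : rho * (1 - T_rho rho) * expR (- T_rho rho) <= mu rho.
  by rewrite /mu le_max lexx orbT.
have := mul_expRN_le_tangent T01 z0.
set T := T_rho rho in T01 hT hm *.
rewrite -ler_pdivrMr ?expR_gt0// -expRN => h.
have rho0 : 0 < rho by lra.
have E : rho - 1 = rho * (T ^+ 2 * expR (- T)) by rewrite hT; field; rewrite gt_eqF.
rewrite E; have := ler_wpM2r z0 hm; have := ler_wpM2l (ltW rho0) h.
nra.
Qed.

(** The right side is minimal at [y = ln 2]. *)
Lemma ln2_le_shift (y : R) : ln 2 <= y - 1 + 2 * expR (- y).
Proof.
have := @expR_ge1Dx R (ln 2 - y); rewrite expRD lnK ?posrE ?ltr0n//; lra.
Qed.

(** The case [y = 1] of the shift bound. It provides the endpoint [z = 0] of the convexity argument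
    in [stopping_time]. *)
Lemma mu_ge_half : rho - (rho - 1) * expR 1 <= 2 * mu rho.
Proof.
have := ln2_le_shift 1; rewrite subrr add0r expRN ler_pdivlMr ?expR_gt0// => h.
have := mu_ge_ln2; have := ler_wpM2l mu_ge0 h.
nra.
Qed.

Lemma mu_ge_shift (y : R) :
  rho <= expR 1 * (rho - 1 + mu rho * (y - 1 + 2 * expR (- y))).
Proof.
have h : expR 1 * (mu rho * ln 2) <= expR 1 * (mu rho * (y - 1 + 2 * expR (- y))).
  by rewrite ler_pM2l ?expR_gt0// ler_wpM2l ?mu_ge0// ln2_le_shift.
have := mu_ge_ln2; nra.
Qed.

End MuBounds.

(** * Two-piece strategies and choice of stopping times *)

Lemma partial_strategy_le (R : realType) (u : R) (K K' : R -> R) :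
  (forall x, 0 <= x -> K x <= K' x) ->
  partial_strategy u K -> partial_strategy u K'.
Proof.
move=> KK' [A [mA A0 AK]]; exists A; split => // x x0.
by apply: le_trans (AK _ x0) _; rewrite lee_fin KK'.
Qed.

(* The densities are [d e^t] on [0, b] and [v e^(t - y)] on [y, b']. *)
Lemma two_segment_strategy (R : realType) (q d b w v y b' w' : R) :
  0 <= q -> 0 <= d -> 0 <= b -> w = d * expR b ->
  0 <= v -> 0 <= y <= b' -> w' = v * expR (b' - y) ->
  q + (w - d) + (w' - v) <= 1 ->
  partial_strategy 1 (fun x => q + w * Num.min x b +
    (w' * Num.min x b' - v * Num.min x y) + (1 - (q + (w - d) + (w' - v))) * x).
Proof.
move=> q0 d0 b0 wE v0 /andP[y0 yb] wE' mass.
have S0 := partial_strategy_atom0 (lexx _) q0 (partial_strategy0 R).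
rewrite add0r in S0.
have b00 : (0 : R) <= 0 <= b by rewrite lexx.
have S1 := partial_strategy_exp q0 d0 b00 S0.
have E1 : d * (expR b - expR 0) = w - d by rewrite wE expR0; ring.
rewrite E1 in S1.
have wd : 0 <= w - d by rewrite -E1 mulr_ge0// subr_ge0 ler_expR.
have d20 : 0 <= v * expR (- y) by rewrite mulr_ge0// expR_ge0.
have yb' : 0 <= y <= b' by rewrite y0.
have S2 := partial_strategy_exp (addr_ge0 q0 wd) d20 yb' S1.
have ey : expR (- y) * expR y = 1 by rewrite -expRD addNr expR0.
have eb : expR (- y) * expR b' = expR (b' - y) by rewrite -expRD addrC.
have vE : v * expR (- y) * expR y = v by rewrite -mulrA ey mulr1.
have E2 : v * expR (- y) * (expR b' - expR y) = w' - v.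
  by rewrite mulrBr vE wE' -eb mulrA.
rewrite E2 in S2.
have wv : 0 <= w' - v by rewrite -E2 mulr_ge0// subr_ge0 ler_expR.
have m0 : 0 <= q + (w - d) + (w' - v) by apply: addr_ge0 => //; exact: addr_ge0.
have m1 : 0 <= 1 - (q + (w - d) + (w' - v)) by rewrite subr_ge0.
have := partial_strategy_never m0 m1 S2.
rewrite [X in partial_strategy X _](_ : _ = 1); last by ring.
apply: partial_strategy_le => x x0.
rewrite expR0 (min_r x0) (mulrBr (v * _)) !mulrA vE wE wE' -eb.
by rewrite le_eqVlt; apply/predU1l; ring.
Qed.

(** Used to run a density until a deadline [c] or until the level [v] is met, whichever comes
    first. *)
Lemma expR_level (R : realType) (p q a c v : R) :
  a <= c -> (p + q * a) * expR a <= v ->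
  exists b, [/\ a <= b <= c, (p + q * b) * expR b <= v &
    b = c \/ (p + q * b) * expR b = v].
Proof.
move=> ac fa.
pose f (b : R) := (p + q * b) * expR b.
have [fc|fc] := leP (f c) v.
  by exists c; split; [rewrite ac lexx|exact: fc|left].
have cf : {within `[a, c], continuous f}.
  apply: continuous_subspaceT => x; apply: cvgM; last exact: continuous_expR.
  apply: cvgD; first exact: cvg_cst.
  by apply: cvgMr; exact: cvg_id.
have [|b bac fb] := IVT ac cf (v := v).
  by rewrite ge_min fa/= le_max (ltW fc) orbT.
by exists b; split; [move: bac; rewrite in_itv|rewrite -/(f b) fb|right].
Qed.

(* [s] is the time at which the probability of not having bought drops to [mu].
   Both [e^-s = (rho - 1 + mu z) / (rho - 2 mu)] and the required upper bound
   [t] on [s] are affine in [z], so convexity of [e^-t] reduces [s <= t] to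
   [z = 0] and to the [z'] at which the stopping time equals [z']. *)
Lemma stopping_time (R : realType) (rho z : R) :
  1 <= rho <= expR 1 / (expR 1 - 1) -> 0 <= z ->
  (rho - 1 + mu rho * z) * expR z < rho - 2 * mu rho ->
  exists s, [/\ 0 <= s <= 1,
    (rho - 1 + mu rho * z) * expR s = rho - 2 * mu rho &
    2 * mu rho * (1 + z - s) <= rho * (1 - s)].
Proof.
move=> hrho z0.
have m0 := mu_ge0 hrho; have m1 := mu_le1 hrho; have [rho1 _] := andP hrho.
have htan := mu_ge_tangent hrho; have hhalf := mu_ge_half hrho.
set m := mu rho in m0 m1 htan hhalf *.
set D := rho - 1 + m * z; set r := rho - 2 * m => hD.
have D0 : 0 <= D by rewrite /D; have := mulr_ge0 m0 z0; lra.
have r0 : 0 < r by apply: le_lt_trans hD; rewrite mulr_ge0// expR_ge0.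
have z1 : z <= 1.
  by rewrite leNgt; apply/negP => z1; have := htan z z0; rewrite -/D /r in hD *; nra.
have [|z' [/andP[zz' z'1] le_r eq_r]] := @expR_level R (rho - 1) m z 1 r z1.
  exact: ltW.
have z'0 : 0 <= z' by lra.
have hz' := htan z' z'0.
(* If the search ends at [z' = 1], the tangent bound gives at least [rho >= r] there, so the level
   is attained anyway. *)
have {}eq_r : (rho - 1 + m * z') * expR z' = r.
  case: eq_r => // z'E; apply/eqP; rewrite eq_le le_r/=.
  by move: hz'; rewrite z'E /r; lra.
rewrite eq_r in hz'.
(* The third conclusion, solved for [s], reads [s <= t]. *)
pose t := 1 - 2 * m * z / r.
have tr : t * r = r - 2 * m * z by rewrite /t; field; rewrite gt_eqF.
have zt : z <= t by rewrite -(ler_pM2r r0) tr; rewrite /r in hz' *; nra.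
have t1 : t <= 1 by rewrite -(ler_pM2r r0) tr; have := mulr_ge0 m0 z0; lra.
have De : r <= D * expR t.
  have [z'E|z'N0] := eqVneq z' 0.
    have zE : z = 0 by lra.
    by rewrite /t /D zE !mulr0 mul0r subr0 addr0 /r; lra.
  have z'_gt0 : 0 < z' by rewrite lt_neqAle eq_sym z'N0.
  have h1 : r * t <= (rho - 1) * expR t.
    have -> : t = 1 + (t - 1) by ring.
    rewrite expRD mulrA; apply: (@le_trans _ _ (r * expR (t - 1))).
      by rewrite ler_pM2l// expR_ge1Dx.
    by rewrite ler_pM2r ?expR_gt0// /r; lra.
  have h2 : r * (1 + (t - z')) <= (rho - 1 + m * z') * expR t.
    have -> : expR t = expR z' * expR (t - z') by rewrite -expRD; congr expR; ring.
    by rewrite mulrA eq_r ler_pM2l// expR_ge1Dx.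
  (* Combine the endpoints [0] ([h1]) and [z'] ([h2]) with weights [z' - z] and [z]; the surplus is
     [z * (r - rho * z')], nonnegative by [hz']. *)
  rewrite -(ler_pM2l z'_gt0).
  have -> : z' * (D * expR t) = (z' - z) * ((rho - 1) * expR t) +
      z * ((rho - 1 + m * z') * expR t) by rewrite /D; ring.
  have zz'0 : 0 <= z' - z by lra.
  apply: le_trans (lerD (ler_wpM2l zz'0 h1) (ler_wpM2l z0 h2)).
  have -> : (z' - z) * (r * t) + z * (r * (1 + (t - z'))) =
      z' * (t * r) + z * r * (1 - z') by ring.
  have hz'' : 0 <= r - rho * z' by lra.
  rewrite tr; have := mulr_ge0 z0 hz''; rewrite /r; nra.
have [|s [/andP[zs st] s_le s_eq]] := @expR_level R D 0 z t r zt.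
  by rewrite mul0r addr0 ltW.
rewrite mul0r addr0 in s_le s_eq.
exists s; split.
- by apply/andP; split; lra.
- by case: s_eq => // sE; apply/eqP; rewrite eq_le s_le/= sE.
- have := ler_wpM2r (ltW r0) st; rewrite tr /r; lra.
Qed.

(** * Predictions at least [1] *)

(** The atom is [m * (1 + z)] and the density [(rho - 1 + m * z) * e^t] on [[0, s]], so before [s]
    cost and bound both have slope [rho - m]. The inequality on [1 + z - s] is the bound at season
    length and prediction [1 + z]. The last hypothesis leaves a probability of at most [m], or none,
    of never buying. *)
Lemma strategy_verified_ge1 (R : realType) (rho m y z s w : R) :
  1 <= rho -> 0 <= m <= 1 -> 0 <= z <= y - 1 -> 0 <= s <= 1 ->
  w = (rho - 1 + m * z) * expR s -> w <= rho - m ->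
  (rho - w) * (1 + z - s) <= rho * (1 - s) ->
  z = y - 1 /\ rho - 2 * m <= w \/ w = rho - m ->
  partial_strategy 1 (fun x => rho * Num.min x 1 + m * `|y - x|).
Proof.
move=> rho1 /andP[m0 m1] /andP[z0 zy] /andP[s0 s1] wE wle hs tail.
have mz := mulr_ge0 m0 z0.
have D0 : 0 <= rho - 1 + m * z by lra.
have w0 : 0 <= w by rewrite wE mulr_ge0// expR_ge0.
have q0 : 0 <= m * (1 + z) by rewrite mulr_ge0//; lra.
have h00 : ((0 : R) <= 0) && ((0 : R) <= 0) by rewrite lexx.
have e00 : 0 = 0 * expR (0 - 0) :> R by rewrite mul0r.
have := two_segment_strategy q0 D0 s0 wE (lexx _) h00 e00.
rewrite subr0 addr0 => S.
apply: partial_strategy_le (S _) => [x x0|]; last by lra.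
rewrite !mul0r subr0 addr0.
set g := (X in X * x); have gE : g = rho - m - w by rewrite /g; ring.
have g0 : 0 <= g by lra.
have {}tail : z = y - 1 /\ g <= m \/ g = 0 by lra.
rewrite gE in g0 tail *.
have mzy : m * z <= m * (y - 1) by rewrite ler_wpM2l.
have [xs|sx] := leP x s.
  rewrite min_l ?(le_trans xs)// ger0_norm; last by lra.
  nra.
have [x1|x1] := leP x 1.
  rewrite ger0_norm; last by lra.
  have := ler_wpM2l w0 (ltW sx); nra.
have [xy|yx] := leP x y.
  rewrite ger0_norm ?subr_ge0//.
  have myx : 0 <= m * (y - x) by rewrite mulr_ge0// subr_ge0.
  case: tail => [[zE gm]|g00]; last by rewrite g00 mul0r; nra.
  have := ler_wpM2l g0 xy; rewrite zE in hs *; nra.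
rewrite ler0_norm; last by lra.
case: tail => [[zE gm]|g00]; last first.
  have := mulr_ge0 m0 (ltW (etrans (subr_gt0 _ _) yx)); rewrite g00 mul0r; nra.
have yx' : 0 <= x - y by lra.
have := ler_wpM2r yx' gm; rewrite zE in hs *; nra.
Qed.

(** Here [z] is [y - 1], capped where buying until [z] exhausts the probability. Stopping at [s = z]
    works, by the tangent bound, once at most [mu] remains; otherwise [z = y - 1] and buying goes on
    as in [stopping_time]. *)
Lemma strategy_prediction_ge1 (R : realType) (rho y : R) :
  1 <= rho <= expR 1 / (expR 1 - 1) -> 1 <= y ->
  partial_strategy 1 (fun x => rho * Num.min x 1 + mu rho * `|y - x|).
Proof.
move=> hrho y1.
have m0 := mu_ge0 hrho; have m1 := mu_le1 hrho; have [rho1 _] := andP hrho.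
have y10 : 0 <= y - 1 by lra.
have [|z [/andP[z0 zy] wle wz]] :=
    @expR_level R (rho - 1) (mu rho) 0 (y - 1) (rho - mu rho) y10.
  by rewrite mulr0 addr0 expR0; lra.
have hz := mu_ge_tangent hrho z0.
have m01 : 0 <= mu rho <= 1 by rewrite m0.
have z0y : 0 <= z <= y - 1 by rewrite z0.
have z01 : 0 <= z <= 1 by rewrite z0/= leNgt; apply/negP => z1; nra.
have [lt_w|w_le] := ltP ((rho - 1 + mu rho * z) * expR z) (rho - 2 * mu rho).
  case: wz => [zE|]; last by lra.
  have [s [s01 wE hs]] := stopping_time hrho z0 lt_w.
  apply: (strategy_verified_ge1 rho1 m01 z0y s01 (esym wE)); first by lra.
    by have -> : rho - (rho - 2 * mu rho) = 2 * mu rho by ring.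
  by left.
apply: (strategy_verified_ge1 rho1 m01 z0y z01 erefl wle); first by lra.
by case: wz; [left|right].
Qed.

(** * Predictions below [1] *)

(* After the prediction, buying with density [v e^(t - y)] until time [1], or
   until nothing is left to buy, keeps the bound tight. *)
Lemma strategy_verified_lt1 (R : realType) (rho m y q d v : R) :
  1 <= rho -> 0 <= m <= 1 -> 0 <= y < 1 -> 0 <= q <= m * y -> 0 <= d ->
  d * expR y <= v -> v <= rho + m -> rho <= v * expR (1 - y) ->
  q + d * expR y - d + rho + m - v = 1 ->
  q + (d * expR y - v) * y + m * y = 0 ->
  partial_strategy 1 (fun x => rho * Num.min x 1 + m * `|y - x|).
Proof.
move=> rho1 /andP[m0 m1] /andP[y0 y1] /andP[q0 qm] d0 dv vle hv massE tight.
have v0 : 0 <= v by apply: le_trans dv; rewrite mulr_ge0// expR_ge0.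
have [|b [/andP[yb b1] wle wb]] :=
    @expR_level R (v * expR (- y)) 0 y 1 (rho + m) (ltW y1).
  by rewrite mul0r addr0 -mulrA -expRD addNr expR0 mulr1.
have wE : (v * expR (- y) + 0 * b) * expR b = v * expR (b - y).
  by rewrite mul0r addr0 -mulrA -expRD addrC.
rewrite wE in wle wb; move: wle wb hv.
set w := v * expR (b - y) => wle wb hv.
(* The probability [rho + m - w] of never buying is at most [m] in the first case and zero in the
   second. *)
have {wb} tail : b = 1 /\ rho <= w \/ w = rho + m.
  by case: wb => [bE|]; [left; rewrite /w bE|right].
have vw : v <= w by rewrite ler_peMr// -expR0 ler_expR subr_ge0.
have yb' : 0 <= y <= b by rewrite y0.
have := two_segment_strategy q0 d0 y0 erefl v0 yb' (erefl w).
set p := d * expR y in dv massE tight * => S.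
apply: partial_strategy_le (S _) => [x x0|]; last by lra.
have -> : 1 - (q + (p - d) + (w - v)) = rho + m - w by lra.
have [xy|yx] := leP x y.
  rewrite !min_l ?ger0_norm ?subr_ge0//; last 2 first.
  - by lra.
  - by lra.
  have [yE|yN0] := eqVneq y 0.
    have -> : x = 0 by lra.
    by rewrite yE in qm *; lra.
  have y_gt0 : 0 < y by rewrite lt_neqAle eq_sym yN0.
  rewrite -subr_ge0 -(pmulr_rge0 _ y_gt0).
  (* both sides are affine in [x] and agree at [x = y] *)
  have -> : y * (rho * x + m * (y - x) -
      (q + p * x + (w * x - v * x) + (rho + m - w) * x)) =
      (m * y - q) * (y - x) - x * (q + (p - v) * y + m * y) by ring.
  by rewrite tight mulr0 subr0 mulr_ge0// subr_ge0.
(* By [tight] the two sides agree at [x = y], and both have slope [rho + m] from there to [b]. *)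
have [xb|bx] := leP x b.
  rewrite min_l; last by lra.
  rewrite ler0_norm; last by lra.
  nra.
rewrite ler0_norm; last by lra.
case: tail => [[bE rw]|wE'].
  rewrite bE in bx *; rewrite (min_r (ltW bx)).
  have rw' : 0 <= w - rho by lra.
  have bx' : 0 <= x - 1 by lra.
  have := mulr_ge0 rw' bx'; nra.
have : rho * b <= rho * Num.min x 1.
  by rewrite ler_wpM2l ?le_min ?(ltW bx)//; lra.
have := ler_wpM2l m0 (ltW bx).
rewrite wE'; nra.
Qed.

Lemma strategy_prediction_lt1 (R : realType) (rho y : R) :
  1 <= rho <= expR 1 / (expR 1 - 1) -> 0 <= y < 1 ->
  partial_strategy 1 (fun x => rho * Num.min x 1 + mu rho * `|y - x|).
Proof.
move=> hrho y01; have [y0 y1] := andP y01.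
have m0 := mu_ge0 hrho; have m1 := mu_le1 hrho; have [rho1 _] := andP hrho.
have m01 : 0 <= mu rho <= 1 by rewrite m0.
have htan := mu_ge_tangent hrho; have hshift := mu_ge_shift hrho y.
set m := mu rho in m0 m1 m01 htan hshift *.
have my1 : m * y <= 1 by nra.
(* An atom [m * y] is tight for vanishing seasons, and slope [rho - m] then forces the initial
   density [rho - 1 - m * (1 - y)]. If that is negative, nothing is bought between [0] and [y], and
   the smaller atom [q] is the one tight at [x = y]. *)
have [D_lt0|D0] := ltP (rho - 1 - m * (1 - y)) 0.
  pose q := (rho - 1) * y / (1 - y).
  have y1' : 0 < 1 - y by lra.
  have qE : q * (1 - y) = (rho - 1) * y by rewrite /q; field; rewrite gt_eqF.
  have q0 : 0 <= q by rewrite divr_ge0 ?mulr_ge0//; lra.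
  have qm : q <= m * y by rewrite -(ler_pM2r y1') qE; nra.
  have q0m : 0 <= q <= m * y by rewrite q0.
  apply: (@strategy_verified_lt1 R rho m y q 0 (rho + m + q - 1)) => //.
  - by rewrite mul0r; lra.
  - by lra.
  - rewrite -(ler_pM2r y1').
    have := htan _ (ltW y1').
    have -> : (rho + m + q - 1) * expR (1 - y) * (1 - y) =
        ((rho + m - 1) * (1 - y) + q * (1 - y)) * expR (1 - y) by ring.
    rewrite qE; set E := expR _.
    have -> : (rho + m - 1) * (1 - y) + (rho - 1) * y = rho - 1 + m * (1 - y) by ring.
    by [].
  - by rewrite mul0r; lra.
  - rewrite mul0r; nra.
set D := rho - 1 - m * (1 - y) in D0.
have my0 : 0 <= m * y by rewrite mulr_ge0.
have [|b [/andP[b0 b_le] w_le w_eq]] := @expR_level R D 0 0 y (rho - m) y0.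
  by rewrite mul0r addr0 expR0 mulr1 /D; lra.
rewrite mul0r addr0 in w_le w_eq.
(* When the prediction comes first, the density jumps there by [2 * m], like the slope of the bound.
   Otherwise all probability is spent by time [b]. *)
case: w_eq => [bE|w_eq].
  rewrite bE in w_le.
  have my0m : 0 <= m * y <= m * y by rewrite my0 lexx.
  apply: (@strategy_verified_lt1 R rho m y (m * y) D (D * expR y + 2 * m)) => //.
  - by lra.
  - by lra.
  - move: hshift; have -> : expR 1 = expR y * expR (1 - y) :> R.
      by rewrite -expRD; congr expR; ring.
    have ey : expR y * expR (- y) = 1 :> R by rewrite -expRD subrr expR0.
    have -> : expR y * expR (1 - y) * (rho - 1 + m * (y - 1 + 2 * expR (- y))) =
      (expR y * D + 2 * m * (expR y * expR (- y))) * expR (1 - y) by rewrite /D; ring.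
    by rewrite ey mulr1 (mulrC (expR y)).
  - by rewrite /D; lra.
  - by ring.
have h00 : ((0 : R) <= 0) && ((0 : R) <= 0) by rewrite lexx.
have e00 : 0 = 0 * expR (0 - 0) :> R by rewrite mul0r.
have := two_segment_strategy my0 D0 b0 erefl (lexx _) h00 e00.
rewrite w_eq subr0 addr0 => S.
apply: partial_strategy_le (S _) => [x x0|]; last by rewrite /D; lra.
have -> : 1 - (m * y + (rho - m - D)) = 0 by rewrite /D; ring.
rewrite !mul0r subr0 !addr0.
have rm : 0 <= rho - m by lra.
have [xb|bx] := leP x b.
  rewrite min_l ?ger0_norm ?subr_ge0; by [lra|nra].
have hb := ler_wpM2l rm (ltW bx).
have [xy|yx] := leP x y.
  rewrite min_l ?ger0_norm ?subr_ge0//; by [lra|nra].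
have hy := ler_wpM2l rm b_le.
have : rho * y <= rho * Num.min x 1.
  by rewrite ler_wpM2l ?le_min ?(ltW yx) ?(ltW y1)//; lra.
have := normr_ge0 (y - x); have := mulr_ge0 m0 (normr_ge0 (y - x)); nra.
Qed.

Theorem theorem1 (R : realType) (rho : R)
    (hrho : 1 <= rho <= expR 1 / (expR 1 - 1)) :
  exists ALG : randomized_algorithm R,
    forall alpha beta l tau : R,
      0 < alpha -> 0 < beta -> 0 <= l -> 0 <= tau ->
      (expected_cost alpha beta l (ALG alpha beta tau) <=
        (rho * OPT alpha beta l + mu rho * prediction_error alpha l tau)%:E)%E.
Proof.
pose bound alpha beta tau (X : random_buying_time R) := forall l : R,
  0 < alpha -> 0 < beta -> 0 <= l -> 0 <= tau ->
  (expected_cost alpha beta l X <=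
    (rho * OPT alpha beta l + mu rho * prediction_error alpha l tau)%:E)%E.
suff H alpha beta tau : exists X, bound alpha beta tau X.
  exists (fun alpha beta tau => sval (cid (H alpha beta tau))) => alpha beta l tau.
  exact: (svalP (cid (H alpha beta tau)) l).
(* An arbitrary buying time, used for parameters outside the range of the theorem. *)
have [X0 _] := partial_strategy1_expected_cost (@ltr01 R) (@ltr01 R)
  (strategy_prediction_ge1 hrho (lexx 1)).
have [a0|a0] := ltP 0 alpha; last by exists X0 => l; rewrite ltNge a0.
have [b0|b0] := ltP 0 beta; last by exists X0 => l; rewrite (ltNge 0 beta) b0.
have [t0|t0] := leP 0 tau; last by exists X0 => l _ _ _; rewrite leNgt t0.
pose y := tau * (alpha / beta).
have y0 : 0 <= y by rewrite mulr_ge0// divr_ge0// ltW.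
have S : partial_strategy 1 (fun x => rho * Num.min x 1 + mu rho * `|y - x|).
  have [y1|y1] := leP 1 y; first exact: strategy_prediction_ge1.
  by apply: strategy_prediction_lt1 => //; rewrite y0.
have [X XK] := partial_strategy1_expected_cost a0 b0 S.
exists X => l _ _ l0 _; apply: le_trans (XK _ l0) _.
rewrite lee_fin le_eqVlt; apply/predU1l.
rewrite mulrDr !(mulrCA beta) /OPT /prediction_error; congr (_ * _ + _ * _).
  rewrite minr_pMr ?ltW// mulr1; congr Num.min.
  by field; rewrite gt_eqF.
rewrite -[X in X * `|y - _|](gtr0_norm b0) -[X in _ = X * _](gtr0_norm a0) -!normrM.
congr `|_|; rewrite /y; field; rewrite gt_eqF//.
Qed.
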